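(* Let $n\ge3$, let $P$ be a positive-area local optimum with $\Delta=\delta(P)$, let $\theta=(\lambda,\ell,r,d,u)$ be any normalized KKT multiplier at $P$, with outward reactions $b_i=(r_i-\ell_i,\,u_i-d_i)$ and stress $B=\sum_t\lambda_tB_t$. Then $$B^T=-B,\qquad B\mathbf 1=0,\qquad Bz=2\mathrm i\,b^{\mathbb C},$$ where $z=(x_i+\mathrm i y_i)_i\in\mathbb C^n$ and $b^{\mathbb C}=((r_i-\ell_i)+\mathrm i(u_i-d_i))_i\in\mathbb C^n$, and, viewing $p_i$ and $b_i$ as column vectors in $\mathbb R^2$, $$\sum_i b_i=0,\qquad \sum_i p_ib_i^T=\Delta I_2 .$$
   Context: A configuration is $P=(p_1,\dots,p_n)$ with $p_i=(x_i,y_i)\in[0,1]^2$. For a triple $t=(i,j,k)$, $i<j<k$, put $D_t(P)=\det(p_j-p_i,p_k-p_i)$, $A_t(P)=\tfrac12|D_t(P)|$, and $\delta(P)=\min_tA_t(P)$. A positive-area local optimum is a local maximizer $P$ of $\delta$ on $([0,1]^2)^n$ with $\Delta:=\delta(P)>0$. Put $s_t=\operatorname{sgn}D_t(P)$; near $P$, $A_t=\tfrac12s_tD_t$, which is used for derivatives. A normalized KKT multiplier at $P$ is a tuple of nonnegative reals $\lambda_t$ (all triples $t$), $\ell_i,r_i,d_i,u_i$ ($i\in[n]$) with: $\lambda_t=0$ unless $A_t(P)=\Delta$; $\ell_i=0$ unless $x_i=0$, $r_i=0$ unless $x_i=1$, $d_i=0$ unless $y_i=0$, $u_i=0$ unless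 $y_i=1$; $\sum_t\lambda_t=1$; and $\sum_t\lambda_t\nabla_{p_i}A_t(P)+(\ell_i-r_i,d_i-u_i)=0$ for all $i$. For $t=(i,j,k)$, $i<j<k$, the elementary stress is the $n\times n$ matrix $B_t=s_t(a_tc_t^T-c_ta_t^T)$ with $a_t=e_j-e_i$, $c_t=e_k-e_i$ ($e_i$ the standard basis of $\mathbb R^n$). $\mathbf 1$ is the all-ones vector. *)

(* Defs.v *)
From mathcomp Require Import all_boot all_order all_algebra.
From mathcomp Require Import all_classical all_reals all_analysis.
From mathcomp Require Import complex.
Set Implicit Arguments.
Unset Strict Implicit.
Unset Printing Implicit Defensive.
Import Order.TTheory GRing.Theory Num.Theory.
Import numFieldNormedType.Exports.
Local Open Scope classical_set_scope.
Local Open Scope ring_scope.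

Definition triple (n : nat) : Type :=
  {t : 'I_n * 'I_n * 'I_n | (t.1.1 < t.1.2 < t.2)%N}.

Section Configurations.
Variables (R : realType) (n : nat).

(* A configuration is an n x 2 matrix: row i is (x_i, y_i). *)
Implicit Types (P Q : 'M[R]_(n, 2)) (t : triple n) (i : 'I_n).

Definition ti t : 'I_n := (val t).1.1.
Definition tj t : 'I_n := (val t).1.2.
Definition tk t : 'I_n := (val t).2.

Definition vec2 (a b : R) : 'cV[R]_2 := \col_c (if c == 0 then a else b).

Definition xcoord P i : R := P i 0.
Definition ycoord P i : R := P i 1.
Definition pt P i : 'cV[R]_2 := vec2 (xcoord P i) (ycoord P i).

Definition in_square P : Prop :=
  forall i, 0 <= xcoord P i <= 1 /\ 0 <= ycoord P i <= 1.

Definition orient t P : R :=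
  \det (row_mx (pt P (tj t) - pt P (ti t))
               (pt P (tk t) - pt P (ti t)) : 'M[R]_2).

Definition area t P : R := 2^-1 * `|orient t P|.

(* For n >= 3 this is the minimum over the finite nonempty set of triples; see
   [min_areaP]. *)
Definition min_area P : R := inf (range (area^~ P)).

Definition local_optimum P : Prop :=
  [/\ in_square P,
      \forall Q \near P, in_square Q -> min_area Q <= min_area P
    & 0 < min_area P].

(* The gradient in the coordinates of the i-th point only. For f := area t it is
   the derivative of the actual area, which near any P with orient t P != 0 is
   2^-1 * Num.sg (orient t P) * orient t. *)
Definition grad i (f : 'M[R]_(n, 2) -> R) P : 'cV[R]_2 :=
  \col_c 'D_(delta_mx i c) f P.

(* The fields of a multiplier are lambda, l, r, d, u; the last four belong to the
   constraints 0 <= x_i, x_i <= 1, 0 <= y_i, y_i <= 1. *)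
Record multiplier := Multiplier {
  lam : triple n -> R;
  lft : 'I_n -> R;
  rgt : 'I_n -> R;
  dwn : 'I_n -> R;
  upp : 'I_n -> R
}.

Definition normalized_kkt P (m : multiplier) : Prop :=
  [/\ forall t, 0 <= lam m t,
      forall i, [/\ 0 <= lft m i, 0 <= rgt m i, 0 <= dwn m i & 0 <= upp m i],
      forall t, area t P <> min_area P -> lam m t = 0,
      forall i, [/\ xcoord P i <> 0 -> lft m i = 0,
                    xcoord P i <> 1 -> rgt m i = 0,
                    ycoord P i <> 0 -> dwn m i = 0
                  & ycoord P i <> 1 -> upp m i = 0]
    & \sum_t lam m t = 1 /\
      forall i, \sum_t lam m t *: grad i (area t) P
                + vec2 (lft m i - rgt m i) (dwn m i - upp m i) = 0].

Definition reaction (m : multiplier) i : 'cV[R]_2 :=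
  vec2 (rgt m i - lft m i) (upp m i - dwn m i).

Definition edge (i j : 'I_n) : 'cV[R]_n := delta_mx j 0 - delta_mx i 0.

Definition elementary_stress P t : 'M[R]_n :=
  let a := edge (ti t) (tj t) in
  let c := edge (ti t) (tk t) in
  Num.sg (orient t P) *: (a *m c^T - c *m a^T).

Definition stress P (m : multiplier) : 'M[R]_n :=
  \sum_t lam m t *: elementary_stress P t.

Definition config_complex P : 'cV[R[i]]_n :=
  \col_i (Complex (xcoord P i) (ycoord P i)).

Definition reaction_complex (m : multiplier) : 'cV[R[i]]_n :=
  \col_i (Complex (rgt m i - lft m i) (upp m i - dwn m i)).

End Configurations.

Lemma min_areaP (R : realType) (n : nat) (hn : (3 <= n)%N)
    (P : 'M[R]_(n, 2)) :
  exists2 t : triple n, min_area P = area t P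
    & forall t' : triple n, area t P <= area t' P.
Proof.
case: n hn P => [|[|[|n]]] // _ P.
pose o k : 'I_n.+3 := inord k.
have h0 : ((o 0, o 1, o 2).1.1 < (o 0, o 1, o 2).1.2 < (o 0, o 1, o 2).2)%N.
  by rewrite /= !inordK.
pose t0 : triple n.+3 := exist _ (o 0, o 1, o 2)%N h0.
case: (Order.TotalTheory.arg_minP (fun t : triple n.+3 => area t P)
  (isT : xpredT t0)) => t _ tmin.
exists t => [|t']; last exact: tmin.
apply/eqP; rewrite eq_le; apply/andP; split.
  apply: ge_inf; last by exists t.
  by exists (area t P) => _ [t' _ <-]; exact: tmin.
apply: lb_le_inf; first by exists (area t P), t.
by move=> _ [t' _ <-]; exact: tmin.
Qed.

(* Main.v *)
Require Import Defs.
From mathcomp Require Import all_boot all_order all_algebra.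
From mathcomp Require Import all_classical all_reals all_analysis.
From mathcomp Require Import complex.
From mathcomp Require Import ring lra.
Import Order.TTheory GRing.Theory Num.Theory.
Local Open Scope ring_scope.

(* Where [orient t] does not vanish, half of its absolute value is smooth, and its
   gradient in the i-th point is 1/2 ((B_t y)_i, - (B_t x)_i). Weighted by lambda,
   the KKT stationarity equations therefore read B y = 2 (r - l) and
   B x = - 2 (u - d), which is B z = 2 i b. As B is skew and kills constants, the
   reactions sum to 0. The off-diagonal entries of sum_i p_i b_i^T are
   - x^T B x / 2 and y^T B y / 2, which vanish by skewness; both diagonal entries
   equal x^T B y / 2, and x^T B_t y = s_t D_t = 2 A_t gives x^T B y = 2 Delta. *)

Lemma det_mx22 (K : comNzRingType) (A : 'M[K]_2) :
  \det A = A 0 0 * A 1 1 - A 0 1 * A 1 0.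
Proof.
have lift0 : lift 0 0 = 1 :> 'I_2 by apply: val_inj.
have lift1 : lift 1 0 = 0 :> 'I_2 by apply: val_inj.
rewrite (expand_det_row _ 0) !big_ord_recl big_ord0 /cofactor !det_mx11.
by rewrite !mxE !lift0 lift1 /=; ring.
Qed.

Lemma det_row_mx2 (K : comNzRingType) (u v : 'cV[K]_2) :
  \det (row_mx u v : 'M[K]_2) = u 0 0 * v 1 0 - v 0 0 * u 1 0.
Proof.
(* [row_mxEl] and [row_mxEr] index columns by [lshift] and [rshift]; these agree with the literals 0
   and 1 only by value, hence [val_inj]. *)
have row_mxl i : (row_mx u v : 'M[K]_2) i 0 = u i 0.
  by rewrite -(row_mxEl u v); congr (_ _ _); apply: val_inj.
have row_mxr i : (row_mx u v : 'M[K]_2) i 1 = v i 0.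
  by rewrite -(row_mxEr u v); congr (_ _ _); apply: val_inj.
by rewrite det_mx22 !row_mxl !row_mxr.
Qed.

(** Plain case analysis on ['I_2] yields [Ordinal] terms; this form keeps the literals 0 and 1, so
    later rewrites still match. *)
Lemma forall_ord2 (Q : 'I_2 -> Prop) : Q 0 -> Q 1 -> forall c, Q c.
Proof.
move=> Q0 Q1 [[|[|//]] lt_c2].
  by rewrite (_ : Ordinal lt_c2 = 0) //; apply: val_inj.
by rewrite (_ : Ordinal lt_c2 = 1) //; apply: val_inj.
Qed.

Section NormDerivative.
Import numFieldNormedType.Exports.
Local Open Scope classical_set_scope.

(** Along the line, [f] keeps the sign of [f a] for small [h], so the difference quotient is
    constant near 0 and its limit is that constant. *)
Lemma derive_norm_affine (R : realType) (V : normedModType R)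
    (f : V -> R) (k : R) (a v : V) (g : R) :
    (forall h, f (a + h *: v) = f a + h * g) -> f a != 0 ->
  'D_v (fun x => k * `|f x|) a = k * (Num.sg (f a) * g).
Proof.
move=> fav fa0; rewrite /derive.
apply: lim_near_cst => //.
(* Adding 1 allows division when [g = 0]; for [h] below [|f a| / (|g| + 1)] the increment [h * g]
   cannot change the sign of [f a]. *)
have gp : 0 < `|g| + 1 by rewrite ltr_wpDl.
near=> h.
have h0 : h != 0 by near: h; exact: nbhs_dnbhs_neq.
have hl : `|h| * (`|g| + 1) < `|f a|.
  by rewrite -ltr_pdivlMr //; near: h; apply: dnbhs0_lt; rewrite divr_gt0 ?normr_gt0.
have {}hl : `|h * g| < `|f a|.
  by apply: le_lt_trans hl; rewrite normrM ler_wpM2l // lerDl.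
rewrite /= /shift /= [h *: v + a]addrC fav.
suff -> : `|f a + h * g| = `|f a| + h * (Num.sg (f a) * g).
  by rewrite /GRing.scale /=; field.
move: hl; rewrite ltr_norml => /andP[].
case: (sgrP (f a)) (fa0) => [//|fa_gt0 _|fa_lt0 _].
- by move=> h1 h2; rewrite ger0_norm; lra.
- by move=> h1 h2; rewrite ler0_norm; lra.
Unshelve. all: by end_near.
Qed.
End NormDerivative.

Section Stress.
Variables (R : realType) (n : nat).
Implicit Types (P : 'M[R]_(n, 2)) (t : triple n) (i : 'I_n) (m : multiplier R n).

Lemma orientE t P : orient t P =
  (P (tj t) 0 - P (ti t) 0) * (P (tk t) 1 - P (ti t) 1)
  - (P (tk t) 0 - P (ti t) 0) * (P (tj t) 1 - P (ti t) 1).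
Proof. by rewrite /orient det_row_mx2 !mxE. Qed.

Lemma trmx_edge_mul (i j : 'I_n) (v : 'cV[R]_n) :
  (edge R i j)^T *m v = (v j 0 - v i 0)%:M.
Proof.
rewrite linearB /= !trmx_delta mulmxBl -!rowE [LHS]mx11_scalar.
by rewrite !mxE.
Qed.

Lemma edgeE (i j k : 'I_n) :
  edge R i j k 0 = (k == j)%:R - (k == i)%:R.
Proof. by rewrite !mxE !andbT. Qed.

(** Each rank-one term sees [v] only through its differences along an edge of the triangle, which is
    why constants are killed. *)
Lemma elementary_stress_mul P t (v : 'cV[R]_n) i :
  (elementary_stress P t *m v) i 0 = Num.sg (orient t P) *
    ((v (tk t) 0 - v (ti t) 0) * edge R (ti t) (tj t) i 0
     - (v (tj t) 0 - v (ti t) 0) * edge R (ti t) (tk t) i 0).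
Proof.
rewrite /elementary_stress -scalemxAl mulmxBl -!mulmxA !trmx_edge_mul.
by rewrite !mul_mx_scalar !mxE.
Qed.

Lemma tr_elementary_stress P t :
  (elementary_stress P t)^T = - elementary_stress P t.
Proof.
by rewrite /elementary_stress linearZ linearB /= !trmx_mul !trmxK -scalerN opprB.
Qed.

Lemma stress_mul P m (v : 'cV[R]_n) i : (stress P m *m v) i 0 =
  \sum_t lam m t * (elementary_stress P t *m v) i 0.
Proof.
rewrite /stress mulmx_suml summxE; apply: eq_bigr => t _.
by rewrite -scalemxAl mxE.
Qed.

Lemma tr_stress P m : (stress P m)^T = - stress P m.
Proof.
rewrite /stress linear_sum -sumrN; apply: eq_bigr => t _.
by rewrite linearZ /= tr_elementary_stress scalerN.
Qed.

Lemma stress_const P m (a : R) : stress P m *m (const_mx a : 'cV[R]_n) = 0.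
Proof.
apply/colP => i; rewrite stress_mul big1 ?mxE // => t _.
by rewrite elementary_stress_mul !mxE subrr !mul0r subrr !mulr0.
Qed.

(** Moving one point along one axis changes a single coordinate, in which the determinant is affine,
    so [derive_norm_affine] applies. *)
Lemma grad_area P t i : orient t P != 0 -> grad i (area t) P =
  2^-1 *: vec2 ((elementary_stress P t *m col 1 P) i 0)
               (- (elementary_stress P t *m col 0 P) i 0).
Proof.
move=> P0; rewrite !elementary_stress_mul !edgeE.
(* [e] and [e'] are the rates at which the two edge vectors of the triangle change when point [i]
   moves; one formula then covers every position of [i] relative to [t]. *)
set e : R := (i == tj t)%:R - (i == ti t)%:R.
set e' : R := (i == tk t)%:R - (i == ti t)%:R.
apply/colP => c; rewrite [LHS]mxE.
rewrite (@derive_norm_affine _ _ (orient t) 2^-1 _ _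
  (if c == 0 then (P (tk t) 1 - P (ti t) 1) * e - (P (tj t) 1 - P (ti t) 1) * e'
   else (P (tj t) 0 - P (ti t) 0) * e' - (P (tk t) 0 - P (ti t) 0) * e)) //.
  by rewrite !mxE; case: (c == 0); ring.
move=> h; rewrite !orientE /e /e' !mxE ![i == _]eq_sym.
by case: c => -[|[|//]] hc /=; rewrite ?andbF ?andbT; ring.
Qed.

Lemma mul_tr_edge (v : 'cV[R]_n) (i j : 'I_n) :
  v^T *m edge R i j = (v j 0 - v i 0)%:M.
Proof. by rewrite -[LHS]trmxK trmx_mul trmxK trmx_edge_mul tr_scalar_mx. Qed.

Lemma elementary_stress_form P t :
  (col 0 P)^T *m elementary_stress P t *m col 1 P = `|orient t P|%:M.
Proof.
rewrite /elementary_stress -scalemxAr -scalemxAl mulmxBr mulmxBl.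
rewrite -!mulmxA !trmx_edge_mul !mulmxA !mul_tr_edge -!scalar_mxM -raddfB /=.
by rewrite scale_scalar_mx normrEsg orientE !mxE.
Qed.

(** Each active triple contributes [lam m t] times twice the minimal area, the other triples have
    weight 0, and the weights sum to 1. *)
Lemma stress_form P m :
    (forall t, area t P <> min_area P -> lam m t = 0) -> \sum_t lam m t = 1 ->
  (col 0 P)^T *m stress P m *m col 1 P = (2 * min_area P)%:M.
Proof.
move=> lam_active lam1; rewrite /stress mulmx_sumr mulmx_suml.
rewrite (eq_bigr (fun t => (lam m t * (2 * min_area P))%:M)) => [|t _].
  by rewrite -raddf_sum -mulr_suml lam1 mul1r.
rewrite -scalemxAr -scalemxAl elementary_stress_form scale_scalar_mx.
case: (eqVneq (area t P) (min_area P)) => [<-|/eqP/lam_active->].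
  by rewrite /area mulVKf // pnatr_eq0.
by rewrite !mul0r.
Qed.

(** A 1 x 1 matrix is its own transpose, and transposing the product swaps [u] with [v] and negates
    the stress. *)
Lemma stress_form_skew P m (u v : 'cV[R]_n) :
  u^T *m stress P m *m v = - (v^T *m stress P m *m u).
Proof.
rewrite [LHS]mx11_scalar -tr_scalar_mx -mx11_scalar !trmx_mul trmxK tr_stress.
by rewrite mulNmx mulmxN mulmxA.
Qed.

Lemma stress_diag P m (v : 'cV[R]_n) : (v^T *m stress P m *m v) 0 0 = 0.
Proof.
have := stress_form_skew P m v v; move: (_ *m v) => A /matrixP/(_ 0 0).
by rewrite mxE; lra.
Qed.

Lemma sum_stress_mul P m (v : 'cV[R]_n) : \sum_i (stress P m *m v) i 0 = 0.
Proof.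
have : (const_mx 1 : 'cV[R]_n)^T *m (stress P m *m v) = 0.
  (* By skewness the row of column sums of the stress is minus the transpose of its product with the
     all-ones vector. *)
  rewrite mulmxA -[stress P m]trmxK tr_stress -trmx_mul mulNmx stress_const.
  by rewrite oppr0 trmx0 mul0mx.
move: (stress P m *m v) => w /matrixP/(_ 0 0); rewrite !mxE => w0.
by rewrite -[RHS]w0; apply: eq_bigr => i _; rewrite !mxE mul1r.
Qed.

Lemma stress_coords P m i : normalized_kkt P m -> 0 < min_area P ->
  (stress P m *m col 1 P) i 0 = 2 * (rgt m i - lft m i) /\
  (stress P m *m col 0 P) i 0 = - (2 * (upp m i - dwn m i)).
Proof.
case=> _ _ lam_active _ [_ /(_ i)] + P_gt0.
rewrite (eq_bigr (fun t => lam m t *: (2^-1 *: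
    vec2 ((elementary_stress P t *m col 1 P) i 0)
         (- (elementary_stress P t *m col 0 P) i 0)))) => [kkt|t _]; last first.
  (* A triple carrying weight is active, so [orient t P != 0]: this is where the
     positivity of the minimal area makes [area t] differentiable. *)
  case: (eqVneq (area t P) (min_area P)) => [tP|/eqP/lam_active->]; last first.
    by rewrite !scale0r.
  rewrite grad_area //; apply: contraTneq P_gt0 => t0.
  by rewrite -tP /area t0 normr0 mulr0 ltxx.
rewrite !stress_mul.
move/colP: kkt => kkt; split.
  move: (kkt 0); rewrite !mxE /= summxE.
  rewrite (eq_bigr (fun t => 2^-1 * (lam m t * (elementary_stress P t *m col 1 P) i 0))).
    by rewrite -mulr_sumr; lra.
  by move=> t _; rewrite mxE mulrCA !mxE.
move: (kkt 1); rewrite !mxE /= summxE.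
rewrite (eq_bigr (fun t => - 2^-1 * (lam m t * (elementary_stress P t *m col 0 P) i 0))).
  by rewrite -mulr_sumr; lra.
by move=> t _; rewrite 3!mxE /=; ring.
Qed.

(** A real matrix acts separately on real and imaginary parts, which splits the complex identity
    into the two real ones of [stress_coords]. *)
Lemma mulmx_config_complex P (A : 'M[R]_n) i :
  (map_mx (fun a : R => (a%:C)%C) A *m config_complex P) i 0 =
  Complex ((A *m col 0 P) i 0) ((A *m col 1 P) i 0).
Proof.
rewrite !mxE; apply/eqP; rewrite eq_complex !raddf_sum /=; apply/andP.
by split; apply/eqP/eq_bigr => j _; rewrite !mxE /= mul0r ?subr0 ?addr0.
Qed.

End Stress.

Theorem theorem3p1 (R : realType) (n : nat) (hn : (3 <= n)%N)
    (P : 'M[R]_(n, 2)) (hP : local_optimum P)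
    (m : multiplier R n) (hm : normalized_kkt P m) :
  let B : 'M[R]_n := stress P m in
  [/\ B^T = - B,
      B *m (const_mx 1 : 'cV[R]_n) = 0,
      map_mx (fun a : R => (a%:C)%C) B *m config_complex P =
        (2 * 'i)%C *: reaction_complex m,
      \sum_(i < n) reaction m i = 0
    & \sum_(i < n) pt P i *m (reaction m i)^T = (min_area P)%:M].
Proof.
case: hP => _ _ P_gt0 B; have [_ _ lam_active _ [lam1 _]] := hm.
have BxE i := proj2 (stress_coords _ _ P m i hm P_gt0).
have ByE i := proj1 (stress_coords _ _ P m i hm P_gt0).
have reaction0 i : reaction m i 0 0 = 2^-1 * (B *m col 1 P) i 0.
  by rewrite ByE mxE /= mulKf ?pnatr_eq0.
have reaction1 i : reaction m i 1 0 = - 2^-1 * (B *m col 0 P) i 0.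
  by rewrite BxE mxE /= mulrNN mulKf ?pnatr_eq0.
split; [exact: tr_stress | exact: stress_const | | |].
- apply/colP => i.
  rewrite mulmx_config_complex BxE ByE !mxE -complexiE.
  by apply/eqP; rewrite eq_complex /=; apply/andP; split; apply/eqP; ring.
- apply/colP => c; rewrite summxE mxE; move: c.
  apply: forall_ord2.
  + by rewrite (eq_bigr _ (fun i _ => reaction0 i)) -mulr_sumr sum_stress_mul mulr0.
  + by rewrite (eq_bigr _ (fun i _ => reaction1 i)) -mulr_sumr sum_stress_mul mulr0.
- have form a b :
      \sum_i P i a * (B *m col b P) i 0 = ((col a P)^T *m B *m col b P) 0 0.
    by rewrite -mulmxA [RHS]mxE; apply: eq_bigr => i _; rewrite 2![in RHS]mxE.
  have entry a b : (\sum_i pt P i *m (reaction m i)^T) a b =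
      \sum_i P i a * reaction m i b 0.
    rewrite summxE; apply: eq_bigr => i _.
    rewrite mxE big_ord1 [(reaction m i)^T _ _]mxE; congr (_ * _); move: a.
    by apply: forall_ord2; rewrite mxE.
  have entry0 a : (\sum_i pt P i *m (reaction m i)^T) a 0 =
      2^-1 * ((col a P)^T *m B *m col 1 P) 0 0.
    rewrite entry -form mulr_sumr; apply: eq_bigr => i _.
    by rewrite reaction0 mulrCA.
  have entry1 a : (\sum_i pt P i *m (reaction m i)^T) a 1 =
      - 2^-1 * ((col a P)^T *m B *m col 0 P) 0 0.
    rewrite entry -form mulr_sumr; apply: eq_bigr => i _.
    by rewrite reaction1 mulrCA.
  (* This minus sign cancels the one in [entry1], so the two diagonal entries agree. *)
  have formT : (col 1 P)^T *m B *m col 0 P = - (2 * min_area P)%:M.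
    by rewrite stress_form_skew stress_form.
  have form01 : (col 0 P)^T *m B *m col 1 P = (2 * min_area P)%:M.
    by rewrite stress_form.
  apply/matrixP => a b; move: a b.
  apply: forall_ord2; apply: forall_ord2; rewrite ?entry0 ?entry1.
  + by rewrite form01 !mxE /=; field.
  + by rewrite stress_diag !mxE /= mulr0.
  + by rewrite stress_diag !mxE /= mulr0.
  + by rewrite formT !mxE /=; field.
Qed.
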